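(* Let $k$ be a positive integer, let $G_1,G_2$ be disjoint copies of $C_{3k+2}$, and let $f:V(G_1)\to V(G_2)$ be a function which is not a bijection. Then $\gamma(C(C_{3k+2},f))<2\gamma(C_{3k+2})=2k+2$.
   Context: For disjoint copies $G_1,G_2$ of a graph $G$ and a function $f:V(G_1)\to V(G_2)$, the functigraph $C(G,f)$ has vertex set $V(G_1)\cup V(G_2)$ and edge set $E(G_1)\cup E(G_2)\cup\{uv : u\in V(G_1), v\in V(G_2), v=f(u)\}$. $\gamma$ denotes domination number. *)

(* Defs.v *)
From mathcomp Require Import all_boot.

Set Implicit Arguments.
Unset Strict Implicit.
Unset Printing Implicit Defensive.

(* A graph on the vertex set T is given by its adjacency relation e : rel T. *)

Definition dominating (T : finType) (e : rel T) (D : {set T}) : bool :=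
  [forall v, (v \in D) || [exists u in D, e u v]].

Definition domination_number (T : finType) (e : rel T) : nat :=
  #|[arg min_(D < [set: T] | dominating e D) #|D| ]|.

(* C_n; this is a simple graph only for 2 < n. *)
Definition cycle_graph (n : nat) : rel 'I_n :=
  [rel i j | (j == ordS i) || (i == ordS j)].
Arguments cycle_graph : clear implicits.

(* The summands of T + T carry the disjoint copies G_1 (inl) and G_2 (inr). *)
Definition functigraph (T : finType) (e : rel T) (f : T -> T) : rel (T + T) :=
  fun x y =>
    match x, y with
    | inl u, inl v => e u v
    | inr u, inr v => e u v
    | inl u, inr v => v == f u
    | inr v, inl u => v == f u
    end.

(* arg min returns the default [set: T] when no set satisfies its predicate;
   this never happens here since [set: T] is itself dominating. *)
Lemma domination_numberP (T : finType) (e : rel T) :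
  (exists2 D, dominating e D & #|D| = domination_number e) /\
  (forall D, dominating e D -> domination_number e <= #|D|).
Proof.
rewrite /domination_number; case: arg_minnP => [|D domD minD].
  by apply/forallP => v; rewrite inE.
by split; [exists D|].
Qed.

Lemma cycle_graph_sym n : symmetric (cycle_graph n).
Proof. by move=> i j; exact: orbC. Qed.

Lemma cycle_graph_irr n : 1 < n -> irreflexive (cycle_graph n).
Proof.
move=> n_gt1 i; rewrite /cycle_graph /= orbb; apply/negbTE/eqP.
move=> /(congr1 val) /=; have := ltn_ord i.
rewrite leq_eqVlt => /orP[/eqP En|lt_in]; last by rewrite modn_small // => /n_Sn.
by rewrite En modnn => i0; move: n_gt1; rewrite -En i0.
Qed.

Lemma functigraph_sym (T : finType) (e : rel T) (f : T -> T) :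
  symmetric e -> symmetric (functigraph e f).
Proof. by move=> e_sym [u|u] [v|v] //=. Qed.

Lemma functigraph_irr (T : finType) (e : rel T) (f : T -> T) :
  irreflexive e -> irreflexive (functigraph e f).
Proof. by move=> e_irr [u|u] /=. Qed.

(* Main.v *)
Require Import Defs.
From mathcomp Require Import all_boot.
From mathcomp Require Import zify.

(** Write n = 3k + 2 and call u, w far if going from u to w takes 3j + 1 steps
    for some j <= k; this relation is symmetric because n - (3j + 1) is again of
    that form. If u, w are far, then k vertices suffice to dominate everything
    but u and w; if they are not, then both lie in a dominating set of size
    k + 1. Hence, if exactly one of the pairs (u, w) and (f u, f w) is far, the
    k + 1 vertices chosen on the side of the other pair dominate, through f,
    the two vertices missed by the k vertices, and the functigraph is dominated
    by 2k + 1 vertices. It remains to see that such a pair exists when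
    f a = f b with a != b: take (a, b) if it is far, and otherwise, up to
    swapping a and b so that b lies 3j steps after a, one of the pairs (a, c)
    and (b, c) where c is the successor of a: only the first of them is far, but
    both have the same image. *)

Definition dominated {T : finType} (e : rel T) (D : {set T}) (v : T) : bool :=
  (v \in D) || [exists u in D, e u v].

Lemma dominated_adj (T : finType) (e : rel T) (D : {set T}) (u v : T) :
  u \in D -> e u v -> dominated e D v.
Proof.
by move=> uD uv; apply/orP; right; apply/existsP; exists u; rewrite uD.
Qed.

Lemma val_iter_ordS n t (u : 'I_n) : iter t (@ordS n) u = (u + t) %% n :> nat.
Proof.
elim: t => [|t IHt] /=; first by rewrite addn0 modn_small.
by rewrite IHt -addn1 modnDml addn1 addnS.
Qed.

Lemma iter_ordS_size n (u : 'I_n) : iter n (@ordS n) u = u.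
Proof. by apply: val_inj; rewrite /= val_iter_ordS modnDr modn_small. Qed.

Lemma iter_ordS_surj n (u v : 'I_n) :
  exists2 t, t < n & v = iter t (@ordS n) u.
Proof.
have n_gt0 : 0 < n by case: n u {v} => [[]|].
exists ((v + (n - u)) %% n); first by rewrite ltn_mod.
apply: val_inj; rewrite /= val_iter_ordS modnDmr addnCA subnKC; last exact: ltnW.
by rewrite modnDr modn_small.
Qed.

Lemma iter_ordS_return n a b (u v : 'I_n) :
  a + b = n -> v = iter a (@ordS n) u -> u = iter b (@ordS n) v.
Proof. by move=> abn ->; rewrite -iterD addnC abn iter_ordS_size. Qed.

(** A vertex dominates only itself and its two neighbours, so [D] and its images under [ordS] and
    [ord_pred] cover the cycle. *)
Lemma cycle_dominating_card n (D : {set 'I_n}) :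
  dominating (cycle_graph n) D -> n <= 3 * #|D|.
Proof.
move=> /forallP domD.
have : [set: 'I_n] \subset D :|: (@ordS n @: D :|: @ord_pred n @: D).
  apply/subsetP => v _; rewrite !inE.
  have /orP[->//|/existsP[u /andP[uD /orP[/eqP->|/eqP Eu]]]] := domD v.
    by rewrite imset_f ?orbT.
  by rewrite -[v](@ordSK n) -Eu (imset_f (@ord_pred n) uD) !orbT.
move=> /subset_leq_card; rewrite cardsT card_ord => /leq_trans; apply.
rewrite !mulSn addn0; apply: leq_trans (leq_card_setU _ _) _.
rewrite leq_add2l; apply: leq_trans (leq_card_setU _ _) _.
by apply: leq_add; apply: leq_imset_card.
Qed.

(** With [A] in the first copy and [B] in the second, the edges of [f] let [B] dominate its preimage
    and [A] its image. *)
Lemma functigraph_domination_le (T : finType) (e : rel T) (f : T -> T)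
    (A B : {set T}) :
  (forall v, dominated e A v || (f v \in B)) ->
  (forall v, dominated e B v || (v \in f @: A)) ->
  domination_number (functigraph e f) <= #|A| + #|B|.
Proof.
move=> domA domB; have [_ min] := domination_numberP (functigraph e f).
apply: leq_trans (min (inl @: A :|: inr @: B) _) _; last first.
  apply: leq_trans (leq_card_setU _ _) _.
  by apply: leq_add; apply: leq_imset_card.
have inA u : u \in A -> inl u \in inl @: A :|: inr @: B.
  by move=> uA; rewrite inE imset_f.
have inB u : u \in B -> inr u \in inl @: A :|: inr @: B.
  by move=> uB; rewrite inE orbC imset_f.
apply/forallP => -[v|v].
  have /orP[/orP[/inA->//|/existsP[u /andP[/inA uA uv]]]|/inB fvB] := domA v.
    by apply: dominated_adj uA _.
  by apply: dominated_adj fvB _ => /=.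
have /orP[/orP[/inB->//|/existsP[u /andP[/inB uB uv]]]|/imsetP[u /inA uA Ev]]
  := domB v.
  by apply: dominated_adj uB _.
by apply: dominated_adj uA _; rewrite /= Ev.
Qed.

Section Cycle.

Variable k : nat.
Local Notation n := (3 * k + 2).
Local Notation C := (cycle_graph n).
Local Notation step t u := (iter t (@ordS n) u).

Definition far (u v : 'I_n) : Prop := exists2 j, j <= k & v = step (3 * j + 1) u.

Definition codominating (u v : 'I_n) : Prop :=
  exists D : {set 'I_n}, [/\ #|D| <= k.+1, dominating C D, u \in D & v \in D].

Lemma dominated_step (D : {set 'I_n}) (u : 'I_n) s t :
  step s u \in D -> [|| s == t, s == t.+1 | t == s.+1] ->
  dominated C D (step t u).
Proof.
move=> sD /or3P[/eqP<-|/eqP Es|/eqP Et]; first by rewrite /dominated sD.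
  by apply: dominated_adj sD _; rewrite Es /cycle_graph /= eqxx orbT.
by apply: dominated_adj sD _; rewrite Et /cycle_graph /= eqxx.
Qed.

Lemma codominating_sym u v : codominating u v -> codominating v u.
Proof. by case=> D [cD domD uD vD]; exists D. Qed.

(** One set serves every [j]: the k + 1 vertices lying 0, 3, ..., 3k steps after [u]. *)
Lemma codominating_step u j : j <= k -> codominating u (step (3 * j) u).
Proof.
move=> le_jk; pose D := [set step (3 * i) u | i : 'I_k.+1].
have inD i : i <= k -> step (3 * i) u \in D.
  by rewrite -ltnS => lt_ik; apply/imsetP; exists (Ordinal lt_ik).
exists D; split; last exact: inD; last exact: (inD 0).
  by apply: leq_trans (leq_imset_card _ _) _; rewrite card_ord.
apply/forallP => v; have [t lt_tn ->] := iter_ordS_surj n u v.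
have [Et|lt_t] : t = 3 * k + 1 \/ t < 3 * k + 1 by lia.
  suff -> : step t u = step (n - 1) (step 0 u).
    have := inD 0 isT; rewrite muln0 => D0.
    apply: dominated_adj D0 _; rewrite /cycle_graph /=; apply/orP; right.
    by rewrite -iterS (_ : (n - 1).+1 = n) ?iter_ordS_size //; lia.
  by congr iter; lia.
(* [3 * ((t + 1) %/ 3)] is the multiple of 3 nearest to [t]. *)
by apply: (dominated_step _ _ (3 * ((t + 1) %/ 3))); [apply: inD|]; lia.
Qed.

(** Split on the number t of steps from [u] to [v] modulo 3. In residue 2, the way back from [v] to
    [u] has n - t steps, a multiple of 3. *)
Lemma far_or_codominating u v : far u v \/ codominating u v.
Proof.
have [t lt_tn Ev] := iter_ordS_surj n u v.
have : [|| t == 3 * (t %/ 3), t == 3 * (t %/ 3) + 1 | t == 3 * (t %/ 3) + 2].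
  by lia.
case/or3P => /eqP Et; last 2 first.
- by left; exists (t %/ 3); [lia | rewrite -Et].
- right; apply: codominating_sym.
  rewrite (iter_ordS_return _ _ (3 * (k - t %/ 3)) _ _ _ Ev); last by lia.
  by apply: codominating_step; lia.
by right; rewrite Ev Et; apply: codominating_step; lia.
Qed.

(** Removing [u] and [v] leaves paths of 3j and 3(k - j) vertices. They split into k triples, whose
    midpoints form [D]; the term [j <= i] in [pos] skips [v]. *)
Lemma far_dominated u v : far u v ->
  exists2 D : {set 'I_n}, #|D| <= k &
    forall x, [|| x == u, x == v | dominated C D x].
Proof.
case=> j le_jk ->; pose pos i := 3 * i + 2 + (j <= i).
pose D := [set step (pos i) u | i : 'I_k].
have inD i : i < k -> step (pos i) u \in D.
  by move=> lt_ik; apply/imsetP; exists (Ordinal lt_ik).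
exists D; first by apply: leq_trans (leq_imset_card _ _) _; rewrite card_ord.
move=> x; have [t lt_tn ->] := iter_ordS_surj n u x.
have [->|t_neq0] := eqVneq t 0; first by rewrite eqxx.
have [->|t_neqj] := eqVneq t (3 * j + 1); first by rewrite eqxx orbT.
(* The index of the triple containing [t]: discount [u], and also [v] when [t] lies beyond it. *)
rewrite (dominated_step D u (pos ((t - 1 - (3 * j + 1 < t)) %/ 3))) ?orbT //.
  by apply: inD; lia.
by rewrite /pos; lia.
Qed.

Lemma cycle_domination_number : domination_number C = k.+1.
Proof.
have [[D domD cD] min] := domination_numberP C.
apply/eqP; rewrite eqn_leq; apply/andP; split.
  have u : 'I_n by apply: (@Ordinal _ 0); rewrite addn2.
  have [D' [cD' domD' _ _]] := codominating_step u 0 (leq0n k).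
  exact: leq_trans (min _ domD') cD'.
rewrite -cD; move: #|D| (cycle_dominating_card n D domD) => d; lia.
Qed.

Variable f : 'I_n -> 'I_n.

Lemma far_codominating_image u v : far u v -> codominating (f u) (f v) ->
  domination_number (functigraph C f) <= k + k.+1.
Proof.
move=> /far_dominated[A cA domA] [B [cB /forallP domB fuB fvB]].
apply: leq_trans (leq_add cA cB); apply: functigraph_domination_le => x.
  by have /or3P[/eqP->|/eqP->|->] := domA x; rewrite ?fuB ?fvB ?orbT.
by rewrite /dominated domB.
Qed.

Lemma codominating_far_image u v : codominating u v -> far (f u) (f v) ->
  domination_number (functigraph C f) <= k + k.+1.
Proof.
move=> [A [cA /forallP domA uA vA]] /far_dominated[B cB domB].
rewrite [leqRHS]addnC; apply: leq_trans (leq_add cA cB).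
apply: functigraph_domination_le => x; first by rewrite /dominated domA.
by have /or3P[/eqP->|/eqP->|->] := domB x; rewrite ?imset_f ?orbT.
Qed.

Lemma collision_step a j : 0 < j <= k -> f a = f (step (3 * j) a) ->
  domination_number (functigraph C f) <= k + k.+1.
Proof.
set b := step _ a => /andP[j_gt0 le_jk] fab; pose c := step 1 a.
have far_ac : far a c by exists 0.
have cod_bc : codominating b c.
  (* From [c] to [b] there are 3j - 1 steps, so 3(k - j + 1) lead from [b] on to [c]; this is at
     most 3k because j > 0. *)
  rewrite (iter_ordS_return _ (3 * j - 1) (3 * (k - j + 1)) c b).
  - by apply: codominating_step; lia.
  - by lia.
  by rewrite /c -iterD; congr iter; lia.
have [far_f|cod_f] := far_or_codominating (f a) (f c).
  by apply: codominating_far_image cod_bc _; rewrite -fab.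
exact: far_codominating_image far_ac cod_f.
Qed.

Lemma collision a b : a != b -> f a = f b ->
  domination_number (functigraph C f) <= k + k.+1.
Proof.
move=> neq_ab fab; have [t lt_tn Eb] := iter_ordS_surj n a b.
have t_gt0 : 0 < t.
  by rewrite lt0n; apply: contraNneq neq_ab => t0; rewrite Eb t0.
have : [|| t == 3 * (t %/ 3), t == 3 * (t %/ 3) + 1 | t == 3 * (t %/ 3) + 2].
  by lia.
case/or3P => /eqP Et.
- by apply: (collision_step a (t %/ 3)); [lia | rewrite -Et -Eb].
- apply: (far_codominating_image a b).
    by exists (t %/ 3); [lia | rewrite -Et].
  (* The two images coincide: zero steps apart. *)
  by rewrite -fab; apply: (codominating_step _ 0).
(* In residue 2 the roles of [a] and [b] are swapped. *)
have Ea : a = step (3 * (k - t %/ 3)) b by apply: iter_ordS_return Eb; lia.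
by apply: (collision_step b (k - t %/ 3)); [lia | rewrite -Ea].
Qed.

End Cycle.

Theorem theorem4p5 (k : nat) (k_gt0 : 0 < k)
    (f : 'I_(3 * k + 2) -> 'I_(3 * k + 2)) (f_nbij : ~ bijective f) :
  domination_number (functigraph (cycle_graph (3 * k + 2)) f)
    < 2 * domination_number (cycle_graph (3 * k + 2))
  /\ 2 * domination_number (cycle_graph (3 * k + 2)) = 2 * k + 2.
Proof.
rewrite cycle_domination_number; split; last by lia.
(* An injective self-map of a finite type is bijective. *)
have /injectivePn[a [b neq_ab fab]] : ~~ injectiveb f.
  by apply/injectiveP => /injF_bij.
by have := collision k f a b neq_ab fab; lia.
Qed.
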